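(* Let $p>3$ be prime, $a,b\in\mathbb{Q}_p$ with $ab\ne0$, and suppose $(a,b)\in\Delta_2$. Let ( * ) denote the condition: either [$|D|_p=1$ and $D_0u_{p-2}^2\equiv 0\pmod p$] or [$0\le |D|_p<1$ and $\sqrt{D}$ exists]. Let ( ** ) denote the condition: either [$|D|_p=1$ and $D_0u_{p-2}^2\not\equiv 0,\ 9a_0^2\pmod p$] or [$0<|D|_p<1$ and $\sqrt{D}$ does not exist]. Then the equation $x^3+ax=b$ is 1. solvable in $(\mathbb{Z}_p^* )^{[3]}$ iff $|b|_p=1$ and ( * ) holds; 2. solvable in $(\mathbb{Z}_p\setminus\mathbb{Z}_p^* )^{[3]}$ iff $|b|_p<1$ and ( * ) holds; 3. solvable in $(\mathbb{Q}_p\setminus\mathbb{Z}_p)^{[3]}$ iff $|b|_p>1$ and ( * ) holds; 4. solvable in $(\mathbb{Z}_p^* )^{[1]}$ iff $|b|_p=1$ and ( ** ) holds; 5. solvable in $(\mathbb{Z}_p\setminus\mathbb{Z}_p^* )^{[1]}$ iff $|b|_p<1$ and ( ** ) holds; 6. solvable in $(\mathbb{Q}_p\setminus\mathbb{Z}_p)^{[1]}$ iff $|b|_p>1$ and ( ** ) holds.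
   Context: $\mathbb{Z}_p=\{x\in\mathbb{Q}_p:|x|_p\le1\}$, $\mathbb{Z}_p^*=\{x:|x|_p=1\}$. Every nonzero $c\in\mathbb{Q}_p$ is written $c=c^*/|c|_p$ with $c^*\in\mathbb{Z}_p^*$, $c^*=c_0+c_1p+\cdots$, $c_0\in\{1,\dots,p-1\}$. For nonzero $c$, ''$\sqrt{c}$ exists'' means $c_0^{(p-1)/2}\equiv1\pmod p$ and $\log_p|c|_p$ is even; for $c=0$, $\sqrt{c}$ is regarded as existing. $D_0=-4a_0^3-27b_0^2$, integers $u_n$: $u_1=0,u_2=-a_0,u_3=b_0,u_{n+3}=b_0u_n-a_0u_{n+1}$. $D=-4(a^* )^3-27(b^* )^2\in\mathbb{Z}_p$ (the discriminant of the normalized equation $y^3+a^*y=b^*$; equals $-4a^3-27b^2$ when $|a|_p=|b|_p=1$). $\Delta_2=\{(a,b): |a|_p^3=|b|_p^2,\ D_0u_{p-2}^2\not\equiv 9a_0^2 \pmod p\}$. Roots are taken in $\mathbb{Q}_p$ counted with multiplicity; ''solvable in $A^{[n]}$'' ($n\in\{1,3\}$) means the equation has exactly $n$ roots in $\mathbb{Q}_p$ (with multiplicity), all lying in $A$. *)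

(* Defs.v *)
From HB Require Import structures.
From mathcomp Require Import all_boot all_order all_algebra.
Set Implicit Arguments. Unset Strict Implicit. Unset Printing Implicit Defensive.
Import Order.TTheory GRing.Theory Num.Theory.
Local Open Scope ring_scope.

Definition cauchy (K : fieldType) (absp : K -> rat) (u : nat -> K) : Prop :=
  forall e : rat, 0 < e -> exists N : nat,
    forall m n : nat, (N <= m)%N -> (N <= n)%N -> absp (u m - u n) < e.

Definition converges (K : fieldType) (absp : K -> rat) (u : nat -> K) (l : K) : Prop :=
  forall e : rat, 0 < e -> exists N : nat,
    forall n : nat, (N <= n)%N -> absp (u n - l) < e.

(* (K, absp) is a complete, discretely valued, non-archimedean field with
   |p| = 1/p, value group p^Z and residue field F_p.  These axioms determine
   (K, absp) uniquely up to isometric field isomorphism as (Q_p, |.|_p). *)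
Record is_Qp (p : nat) (K : fieldType) (absp : K -> rat) : Prop := {
  absp_eq0 : forall x : K, (absp x == 0) = (x == 0);
  abspM : forall x y : K, absp (x * y) = absp x * absp y;
  abspD : forall x y : K, absp (x + y) <= Num.max (absp x) (absp y);
  absp_p : absp (p%:R) = (p%:R : rat)^-1;
  absp_val : forall x : K, x != 0 -> exists z : int, absp x = (p%:R : rat) ^ z;
  absp_residue : forall x : K, absp x <= 1 ->
     exists2 n : nat, (n < p)%N & absp (x - n%:R) < 1;
  absp_complete : forall u : nat -> K, cauchy absp u -> exists l : K, converges absp u l
}.

Arguments is_Qp p K absp : clear implicits.

Section Notions.
Variables (p : nat) (K : fieldType) (absp : K -> rat).

Definition cstar (c : K) : K := c * ratr (absp c).

Definition digit0 (c : K) : nat :=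
  find (fun n : nat => absp (cstar c - n%:R) < 1) (iota 0 p).

Definition sqrt_exists (c : K) : Prop :=
  c = 0 \/
  ((exists k : int, absp c = (p%:R : rat) ^ (k * 2)) /\
   (digit0 c ^ ((p - 1) %/ 2) = 1 %[mod p])%N).

Definition Zp_unit : pred K := fun x => absp x == 1.
Definition Zp_nonunit : pred K := fun x => absp x < 1.
Definition Qp_nonint : pred K := fun x => 1 < absp x.

Definition cubic (a b : K) : {poly K} := 'X^3 + a *: 'X - b%:P.

(* "solvable in A^[n]": exactly n roots in K counted with multiplicity,
   all lying in A *)
Definition solvable_in (A : pred K) (n : nat) (f : {poly K}) : Prop :=
  exists s : seq K,
    [/\ size s = n, all A s &
        exists g : {poly K},
          f = (\prod_(r <- s) ('X - r%:P)) * g /\ forall x : K, ~~ root g x].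

Definition Disc (a b : K) : K :=
  - (4%:R * cstar a ^+ 3) - 27%:R * cstar b ^+ 2.

End Notions.

Definition D0 (a0 b0 : int) : int := - (4 * a0 ^+ 3) - 27 * b0 ^+ 2.

Fixpoint utrip (a0 b0 : int) (n : nat) : int * int * int :=
  match n with
  | 0 => (0, - a0, b0)
  | n'.+1 => let: (x, y, z) := utrip a0 b0 n' in (y, z, b0 * x - a0 * y)
  end.

(* u_k for k >= 1 : u_1 = 0, u_2 = -a0, u_3 = b0, u_{n+3} = b0 u_n - a0 u_{n+1} *)
Definition useq (a0 b0 : int) (k : nat) : int := (utrip a0 b0 k.-1).1.1.

Section Conditions.
Variables (p : nat) (K : fieldType) (absp : K -> rat).
Variables (a b : K).

Definition a0 : int := (digit0 p absp a)%:Z.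
Definition b0 : int := (digit0 p absp b)%:Z.
Definition Dint : int := D0 a0 b0 * (useq a0 b0 (p - 2)) ^+ 2.

Definition in_Delta2 : Prop :=
  absp a ^+ 3 = absp b ^+ 2 /\ ~ (Dint = 9 * a0 ^+ 2 %[mod p%:Z])%Z.

Definition cond_star : Prop :=
  (absp (Disc absp a b) = 1 /\ (Dint = 0 %[mod p%:Z])%Z) \/
  (absp (Disc absp a b) < 1 /\ sqrt_exists p absp (Disc absp a b)).

Definition cond_2star : Prop :=
  (absp (Disc absp a b) = 1 /\ ~ (Dint = 0 %[mod p%:Z])%Z
     /\ ~ (Dint = 9 * a0 ^+ 2 %[mod p%:Z])%Z) \/
  (0 < absp (Disc absp a b) < 1 /\ ~ sqrt_exists p absp (Disc absp a b)).

End Conditions.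

(* Main.v *)
Require Import Defs.
From HB Require Import structures.
From mathcomp Require Import all_boot all_order all_algebra all_field.
From mathcomp Require Import ring zify.
Import Order.TTheory GRing.Theory Num.Theory.
Local Open Scope ring_scope.

(* Rescaling by a power of [p] reduces to units [a], [b].  Over an algebraic closure
   of [F_p], [u_n] is the complete homogeneous symmetric function of the three roots,
   so [sqrt D * u_(p-2)] is an alternant in the roots and their [p]-th powers.
   Reading it off according to the permutation that Frobenius induces on the roots
   shows that, for [D] a unit, [D u_(p-2)^2 = 9 a0^2] mod [p] exactly when there is no
   root mod [p], and otherwise [D u_(p-2)^2 = 0] exactly when [D] is a square mod [p].
   Hence on [Delta_2] there is a simple root mod [p] ([-3b/a] when [p] divides [D]),
   which lifts to a root [r] by Hensel.  The cofactor [X^2 + r X + r^2 + a] has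
   discriminant [D / (3 r^2 + a)^2], so it splits iff [D] is a square in [Q_p]; this
   is condition ( * ), and its failure is ( ** ).  Every root has [|r|^3 = |b|]. *)

(** * The prime field and its squares inside an algebraically closed field *)

Section PrimeCharacteristic.

Variables (p : nat) (L : closedFieldType).
Hypothesis charL : p \in [pchar L].

(** The images of [0, ..., p - 1] are already [p] distinct roots of [X^p - X], whose degree is [p];
    another fixed point would be one root too many. *)
Lemma Frobenius_fixed_nat (x : L) : x ^+ p = x -> exists n : nat, x = n%:R.
Proof.
move=> xp; have pp := pcharf_prime charL.
have szP : size ('X^p - 'X : {poly L}) = p.+1.
  by rewrite size_polyDl size_polyXn // size_polyN size_polyX ltnS prime_gt1.
pose rs : seq L := [seq i%:R | i <- iota 0 p].
have uniq_rs : uniq rs.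
  rewrite map_inj_in_uniq ?iota_uniq // => i j.
  rewrite !mem_iota !add0n /= => ip jp.
  wlog le_ij : i j ip jp / (i <= j)%N.
    by move=> W e; case/orP: (leq_total i j) => h; [|symmetry]; apply: W.
  move=> e; apply/eqP; rewrite eqn_leq le_ij /= -subn_eq0.
  have : (j - i)%:R == 0 :> L by rewrite natrB // e subrr.
  rewrite -(dvdn_pcharf charL) => /dvdn_leq; lia.
have roots_rs : all (root ('X^p - 'X : {poly L})) rs.
  apply/allP => _ /mapP[i _ ->].
  by rewrite rootE !hornerE -(pFrobenius_autE charL) pFrobenius_aut_nat subrr.
case: (boolP (x \in rs)) => [/mapP[i _ ->]|xNrs]; first by exists i.
have /max_poly_roots : ('X^p - 'X : {poly L}) != 0 by rewrite -size_poly_eq0 szP.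
move=> /(_ (x :: rs)); rewrite /= roots_rs uniq_rs xNrs szP size_map size_iota ltnn.
by rewrite rootE !hornerE xp subrr eqxx => /(_ isT isT).
Qed.

Lemma closed_sqrt (c : L) : exists w, w ^+ 2 = c.
Proof.
have [w] : exists w, root ('X^2 - c%:P) w.
  by apply: closed_rootP; rewrite size_XnsubC.
by rewrite rootE !hornerE subr_eq0 => /eqP wc; exists w.
Qed.

(** If [w ^+ 2 = n], then [n ^ ((p - 1) / 2) = w ^ (p - 1)], so the criterion says that Frobenius
    fixes [w], that is, that [w] lies in the prime field. *)
Lemma Euler_criterion (n : nat) : odd p -> n%:R != 0 :> L ->
  (n%:R ^+ ((p - 1) %/ 2) == 1 :> L) <-> exists m : nat, n%:R = m%:R ^+ 2 :> L.
Proof.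
move=> p_odd n0; have pp := pcharf_prime charL.
have [w wn] := closed_sqrt n%:R.
have w0 : w != 0 by apply: contraNneq n0 => w0; rewrite -wn w0 expr0n.
have fixE : (n%:R ^+ ((p - 1) %/ 2) == 1 :> L) = (w ^+ p == w).
  rewrite -wn -exprM; have -> : (2 * ((p - 1) %/ 2) = p.-1)%N by lia.
  by rewrite -[in RHS](prednK (prime_gt0 pp)) exprS -[X in _ = (_ == X)]mulr1 (inj_eq (mulfI w0)).
rewrite fixE; split=> [/eqP /Frobenius_fixed_nat[m wm]|[m nm]].
  by exists m; rewrite -wn wm.
have /eqP : (w - m%:R) * (w + m%:R) = 0 by rewrite -subr_sqr wn nm subrr.
rewrite mulf_eq0 subr_eq0 addr_eq0 => /orP[]/eqP->.
  by rewrite -(pFrobenius_autE charL) pFrobenius_aut_nat.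
by rewrite -(pFrobenius_autE charL) rmorphN /= pFrobenius_aut_nat.
Qed.

End PrimeCharacteristic.

(* [u_n] is the complete homogeneous symmetric polynomial [h_n] of the roots,
   and this is Jacobi's bialternant formula for it. *)
Lemma utrip_alternant (L : fieldType) (a0 b0 : int) (x y z : L) (n : nat) :
    x + y + z = 0 -> a0%:~R = x * y + y * z + z * x -> b0%:~R = x * y * z ->
  let V := (x - y) * (x - z) * (y - z) in
  let h k := x ^+ k.+2 * (y - z) - y ^+ k.+2 * (x - z) + z ^+ k.+2 * (x - y) in
  let u := utrip a0 b0 n in
  [/\ V * u.1.1%:~R = h n.+1, V * u.1.2%:~R = h n.+2 & V * u.2%:~R = h n.+3].
Proof.
move=> e1 e2 e3 V h; have {e1}ez : z = - x - y by rewrite -[RHS]addr0 -e1; ring.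
elim: n => [|n] /=.
  by rewrite mulr0z rmorphN /= e2 e3 /V /h ez; split; ring.
case: (utrip a0 b0 n) => [[u1 u2] u3] /= [h1 h2 h3]; split=> //.
rewrite rmorphB !rmorphM /= e2 e3.
have -> : V * (x * y * z * u1%:~R - (x * y + y * z + z * x) * u2%:~R) =
  x * y * z * (V * u1%:~R) - (x * y + y * z + z * x) * (V * u2%:~R) by ring.
by rewrite h1 h2 /h ez !exprS; ring.
Qed.

(** * The action of Frobenius on the roots of the cubic modulo [p] *)

Section CubicResidue.

Variables (p : nat) (L : closedFieldType).
Hypothesis charL : p \in [pchar L].
Hypothesis p_gt3 : (3 < p)%N.

Lemma natr_small_neq0 (n : nat) : (0 < n < p)%N -> n%:R != 0 :> L.
Proof. by case/andP=> n0 np; rewrite -(dvdn_pcharf charL) gtnNdvd. Qed.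

(** Given one root [x], the other two are the roots of [X^2 + x X + x^2 + a], of discriminant
    [- 3 x^2 - 4 a], and the quadratic formula applies because [2] is invertible. *)
Lemma closed_depressed_cubic (a b : L) : exists x y z,
  [/\ x + y + z = 0, a = x * y + y * z + z * x & b = x * y * z].
Proof.
have sz : size ('X^3 + a *: 'X - b%:P) = 4.
  rewrite -addrA size_polyDl size_polyXn //.
  apply: leq_ltn_trans (size_polyD _ _) _; rewrite gtn_max.
  rewrite (leq_ltn_trans (size_scale_leq _ _)) ?size_polyX //=.
  by rewrite size_polyN (leq_ltn_trans (size_polyC_leq1 _)).
have [x] : exists x, root ('X^3 + a *: 'X - b%:P) x.
  by apply: closed_rootP; rewrite sz.
rewrite rootE !hornerE subr_eq0 => /eqP xb.
have [w ww] := closed_sqrt _ (- (3 * x ^+ 2) - 4 * a).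
have n2 : 2%:R != 0 :> L by apply: natr_small_neq0; lia.
exists x, ((w - x) / 2), ((- w - x) / 2).
have n4 : 4%:R != 0 :> L by rewrite (natrM _ 2 2) mulf_neq0.
have aE : a = - (w ^+ 2 + 3 * x ^+ 2) / 4.
  by apply: (mulIf n4); rewrite divfK // ww; ring.
by split; [field | rewrite aE; field | rewrite -xb aE; field]; rewrite ?n2.
Qed.

Local Notation frob := (pFrobenius_aut charL).

Lemma cubic_residue (a0 b0 : int) :
    let D : L := (D0 a0 b0)%:~R in
    let u : L := (useq a0 b0 (p - 2))%:~R in
    D != 0 -> b0%:~R != 0 :> L -> D * u ^+ 2 != 9 * a0%:~R ^+ 2 ->
  (exists n : nat, n%:R ^+ 3 + a0%:~R * n%:R = b0%:~R :> L) /\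
  (D * u ^+ 2 = 0 <-> exists m : nat, D = m%:R ^+ 2).
Proof.
move=> D u Dn0 bn0 Du2_neq.
have n2 : 2%:R != 0 :> L by apply: natr_small_neq0; lia.
have n3 : 3%:R != 0 :> L by apply: natr_small_neq0; lia.
have [x [y [z [e1 e2 e3]]]] := closed_depressed_cubic a0%:~R b0%:~R.
pose V (x y z : L) := (x - y) * (x - z) * (y - z).
pose W (x y z : L) := frob x * (y - z) - frob y * (x - z) + frob z * (x - y).
have ez : z = - x - y by rewrite -[RHS]addr0 -e1; ring.
have DV : D = V x y z ^+ 2.
  rewrite /D /D0 rmorphB rmorphN !rmorphM /= e2 e3 /V ez.
  by ring.
have VW : V x y z * u = W x y z.
  (* [utrip n] starts at [u_(n+1)], so the index [p - 3] yields [u_(p-2)]; the exponent in the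
     alternant is then exactly [p], which turns the powers into Frobenius images. *)
  have [/= + _ _] := @utrip_alternant L a0 b0 x y z (p - 3) e1 e2 e3.
  have -> : (p - 3).+3 = p by lia.
  have -> : (p - 3 = (p - 2).-1)%N by lia.
  by rewrite /u /useq /W !pFrobenius_autE.
have DW : D * u ^+ 2 = W x y z ^+ 2 by rewrite DV -VW; ring.
have sqr_nat (r : L) (m : nat) : r ^+ 2 = m%:R ^+ 2 -> frob r = r.
  move/eqP; rewrite eqf_sqr => /orP[]/eqP->; first exact: pFrobenius_aut_nat.
  by rewrite rmorphN /= pFrobenius_aut_nat.
have fixed_nat (r : L) : frob r = r -> exists n : nat, r = n%:R.
  by rewrite pFrobenius_autE; apply: Frobenius_fixed_nat.
have frob_root (t : L) : (t - x) * (t - y) * (t - z) = 0 ->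
    [\/ frob t = x, frob t = y | frob t = z].
  move=> tE.
  have rE : (frob t - x) * (frob t - y) * (frob t - z) = frob ((t - x) * (t - y) * (t - z)).
    have expand s : (s - x) * (s - y) * (s - z) = s ^+ 3 + a0%:~R * s - b0%:~R.
      by rewrite e2 e3 ez; ring.
    by rewrite !expand rmorphB rmorphD rmorphXn rmorphM /= !rmorph_int.
  move/eqP: rE; rewrite tE rmorph0 !mulf_eq0 !subr_eq0.
  by case/orP=> [/orP[]|] /eqP ->; [apply: Or31|apply: Or32|apply: Or33].
have frob_inj : injective frob by apply: fmorph_inj.
have : V x y z != 0 by apply: contraNneq Dn0 => V0; rewrite DV V0 expr0n.
rewrite /V !mulf_eq0 !subr_eq0 !negb_or -andbA => /and3P[nxy nxz nyz].
(* Here [W = 3 r (s - t)] up to sign, which is nonzero because [r] divides [b0]. Frobenius negates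
   the square root [V] of [D], so [D] has no square root in the prime field. *)
have transposition (r s t : L) : r + s + t = 0 ->
    a0%:~R = r * s + s * t + t * r -> b0%:~R = r * s * t -> s != t ->
    D = V r s t ^+ 2 -> D * u ^+ 2 = W r s t ^+ 2 ->
    frob r = r -> frob s = t -> frob t = s ->
  (exists n : nat, n%:R ^+ 3 + a0%:~R * n%:R = b0%:~R :> L) /\
  (D * u ^+ 2 = 0 <-> exists m : nat, D = m%:R ^+ 2).
  move=> f1 f2 f3 nst DV' DW' fr fs ft.
  have er : t = - r - s by rewrite -[RHS]addr0 -f1; ring.
  split.
    have [n rn] := fixed_nat r fr; exists n; rewrite -rn f2 f3 er; ring.
  split.
    rewrite DW' /W fr fs ft => /eqP; rewrite sqrf_eq0.
    have -> : r * (s - t) - t * (r - t) + s * (r - s) = 3 * r * (s - t).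
      by rewrite er; ring.
    have r0 : r != 0 by apply: contraNneq bn0 => r0; rewrite f3 r0 !mul0r.
    by rewrite !mulf_eq0 (negPf n3) (negPf r0) subr_eq0 (negPf nst).
  case=> m Dm; move: (Dm); rewrite DV' => /sqr_nat.
  have -> : frob (V r s t) = - V r s t.
    by rewrite /V !rmorphM !rmorphB /= fr fs ft; ring.
  move/eqP; rewrite -subr_eq0 -opprD oppr_eq0 -mulr2n -mulr_natl mulf_eq0 (negPf n2) /=.
  by move/eqP => V0; move: Dn0; rewrite DV' V0 expr0n eqxx.
have not_9a2 : W x y z ^+ 2 != 9 * a0%:~R ^+ 2 by rewrite -DW.
(* Frobenius permutes the roots: the identity gives three rational roots and [W = 0],
   a transposition gives one rational root and [W <> 0], and a 3-cycle gives
   [W = +-3 a0], hence [D u^2 = 9 a0^2]. *)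
have [fx|fx|fx] : [\/ frob x = x, frob x = y | frob x = z] by apply: frob_root; ring.
- have [fy|fy|fy] : [\/ frob y = x, frob y = y | frob y = z] by apply: frob_root; ring.
  + by move: nxy; rewrite -(inj_eq frob_inj) fx fy eqxx.
  + have [fz|fz|fz] : [\/ frob z = x, frob z = y | frob z = z] by apply: frob_root; ring.
    * by move: nxz; rewrite -(inj_eq frob_inj) fx fz eqxx.
    * by move: nyz; rewrite -(inj_eq frob_inj) fy fz eqxx.
    split.
      have [n xn] := fixed_nat x fx; exists n; rewrite -xn e2 e3 ez; ring.
    split=> [_|_]; last by rewrite DW /W fx fy fz; ring.
    (* All three roots being fixed, [V] itself is a square root of [D] in the prime field. *)
    have [|m Vm] := fixed_nat (V x y z); last by exists m; rewrite DV Vm.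
    by rewrite /V !rmorphM !rmorphB /= fx fy fz.
  + have [fz|fz|fz] : [\/ frob z = x, frob z = y | frob z = z] by apply: frob_root; ring.
    * by move: nxz; rewrite -(inj_eq frob_inj) fx fz eqxx.
    * exact: (transposition x y z).
    * by move: nyz; rewrite -(inj_eq frob_inj) fy fz eqxx.
- have [fy|fy|fy] : [\/ frob y = x, frob y = y | frob y = z] by apply: frob_root; ring.
  + have [fz|fz|fz] : [\/ frob z = x, frob z = y | frob z = z] by apply: frob_root; ring.
    * by move: nyz; rewrite -(inj_eq frob_inj) fy fz eqxx.
    * by move: nxz; rewrite -(inj_eq frob_inj) fx fz eqxx.
    * apply: (transposition z x y) => //; first 3 last.
      - by rewrite DV /V; ring.
      - by rewrite DW /W; ring.
      - by rewrite -e1; ring.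
      - by rewrite e2; ring.
      - by rewrite e3; ring.
  + by move: nxy; rewrite -(inj_eq frob_inj) fx fy eqxx.
  + have [fz|fz|fz] : [\/ frob z = x, frob z = y | frob z = z] by apply: frob_root; ring.
    * by case/eqP: not_9a2; rewrite /W fx fy fz e2 ez; ring.
    * by move: nxz; rewrite -(inj_eq frob_inj) fx fz eqxx.
    * by move: nyz; rewrite -(inj_eq frob_inj) fy fz eqxx.
- have [fy|fy|fy] : [\/ frob y = x, frob y = y | frob y = z] by apply: frob_root; ring.
  + have [fz|fz|fz] : [\/ frob z = x, frob z = y | frob z = z] by apply: frob_root; ring.
    * by move: nyz; rewrite -(inj_eq frob_inj) fy fz eqxx.
    * by case/eqP: not_9a2; rewrite /W fx fy fz e2 ez; ring.
    * by move: nxz; rewrite -(inj_eq frob_inj) fx fz eqxx.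
  + have [fz|fz|fz] : [\/ frob z = x, frob z = y | frob z = z] by apply: frob_root; ring.
    * apply: (transposition y x z) => //; first 3 last.
      - by rewrite DV /V; ring.
      - by rewrite DW /W; ring.
      - by rewrite -e1; ring.
      - by rewrite e2; ring.
      - by rewrite e3; ring.
    * by move: nyz; rewrite -(inj_eq frob_inj) fy fz eqxx.
    * by move: nxz; rewrite -(inj_eq frob_inj) fx fz eqxx.
  + by move: nxy; rewrite -(inj_eq frob_inj) fx fy eqxx.
Qed.

End CubicResidue.


(** * Transfer of these results to congruences between integers *)

Lemma closure_of_Fp (p : nat) : prime p -> exists L : closedFieldType, p \in [pchar L].
Proof.
move=> pp; have [L [f _]] := countable_algebraic_closure 'F_p.
by exists L; apply: (rmorph_pchar f); apply: pchar_Fp.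
Qed.

Lemma Euler_criterion_mod (p n : nat) : prime p -> odd p -> ~~ (p %| n)%N ->
  (n ^ ((p - 1) %/ 2) = 1 %[mod p])%N <->
  exists m : nat, (p %| n%:Z - m%:Z ^+ 2)%Z.
Proof.
move=> pp p_odd pn; have [L charL] := closure_of_Fp p pp.
have n0 : n%:R != 0 :> L by rewrite -(dvdn_pcharf charL).
have E := Euler_criterion p L charL n p_odd n0.
have eqL (x y : int) : (p %| x - y)%Z = (x%:~R == y%:~R :> L).
  by rewrite (dvdz_pcharf charL) rmorphB subr_eq0.
have -> : (n ^ ((p - 1) %/ 2) = 1 %[mod p])%N <->
    (n%:R ^+ ((p - 1) %/ 2) == 1 :> L).
  have := eqL (n ^ ((p - 1) %/ 2))%N%:Z 1%N%:Z; rewrite -!pmulrn natrX => <-.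
  by rewrite -eqz_mod_dvd !modz_nat eqz_nat; split=> /eqP.
rewrite E; split=> -[m hm]; exists m.
  by rewrite eqL rmorphXn /= -!pmulrn hm.
by move: hm; rewrite eqL rmorphXn /= -!pmulrn => /eqP.
Qed.

Lemma cubic_residue_mod (p : nat) (a0 b0 : int) :
    let u2 := D0 a0 b0 * useq a0 b0 (p - 2) ^+ 2 in
    prime p -> (3 < p)%N -> ~~ (p %| D0 a0 b0)%Z -> ~~ (p %| b0)%Z ->
    ~ (u2 = 9 * a0 ^+ 2 %[mod p%:Z])%Z ->
  (exists n : nat, (p %| n%:Z ^+ 3 + a0 * n%:Z - b0)%Z) /\
  ((u2 = 0 %[mod p%:Z])%Z <-> exists m : nat, (p %| D0 a0 b0 - m%:Z ^+ 2)%Z).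
Proof.
move=> u2 pp p3 pD pb not9; have [L charL] := closure_of_Fp p pp.
have eqL (x y : int) : (p %| x - y)%Z = (x%:~R == y%:~R :> L).
  by rewrite (dvdz_pcharf charL) rmorphB subr_eq0.
have u2E : u2%:~R = (D0 a0 b0)%:~R * (useq a0 b0 (p - 2))%:~R ^+ 2 :> L.
  by rewrite rmorphM rmorphXn.
have [| | |[n hn] sqE] := cubic_residue p L charL p3 a0 b0.
- by rewrite -(dvdz_pcharf charL).
- by rewrite -(dvdz_pcharf charL).
- rewrite -u2E; apply/eqP => u2L; apply: not9; apply/eqP.
  by rewrite eqz_mod_dvd eqL u2L rmorphM rmorphXn.
split; first by exists n; rewrite eqL rmorphD rmorphXn rmorphM /= -!pmulrn hn.
have -> : (u2 = 0 %[mod p%:Z])%Z <-> u2%:~R = 0 :> L.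
  by split=> [/eqP|/eqP u20]; [|apply/eqP];
     rewrite eqz_mod_dvd subr0 (dvdz_pcharf charL) // => /eqP.
rewrite u2E sqE; split=> -[m hm]; exists m.
  by rewrite eqL rmorphXn /= -!pmulrn hm.
by move: hm; rewrite eqL rmorphXn /= -!pmulrn => /eqP.
Qed.


(** * Elementary properties of the [p]-adic absolute value *)

Section Padic.

Variables (p : nat) (K : fieldType) (absp : K -> rat).
Hypotheses (HK : is_Qp p K absp) (pp : prime p) (p_gt3 : (3 < p)%N).

Let p_gt1 : 1 < p%:R :> rat.
Proof. by rewrite ltr1n prime_gt1. Qed.
Let p_gt0 : 0 < p%:R :> rat.
Proof. by rewrite ltr0n prime_gt0. Qed.
Let pV_lt1 : (p%:R : rat)^-1 < 1.
Proof. by rewrite invf_lt1. Qed.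
Let abspM := abspM HK.

Lemma absp0 : absp 0 = 0.
Proof. by apply/eqP; rewrite (absp_eq0 HK). Qed.

Lemma absp_gt0 x : (0 < absp x) = (x != 0).
Proof.
have [->|x0] := eqVneq x 0; first by rewrite absp0 ltxx.
by have [z ->] := absp_val HK x0; apply: exprz_gt0.
Qed.

Lemma absp_ge0 x : 0 <= absp x.
Proof. by have [->|x0] := eqVneq x 0; rewrite ?absp0 // ltW // absp_gt0. Qed.

Lemma absp1 : absp 1 = 1.
Proof.
have n0 : absp 1 != 0 by rewrite (absp_eq0 HK) oner_eq0.
by apply: (mulfI n0); rewrite -abspM !mulr1.
Qed.

Lemma abspX x n : absp (x ^+ n) = absp x ^+ n.
Proof. by elim: n => [|n IH]; rewrite ?absp1 // !exprS abspM IH. Qed.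

Lemma abspN x : absp (- x) = absp x.
Proof.
suff N1 : absp (-1) = 1 by rewrite -mulN1r abspM N1 mul1r.
by apply/eqP; rewrite -(@pexpr_eq1 _ _ 2) ?absp_ge0 // -abspX sqrrN expr1n absp1.
Qed.

Lemma abspV x : absp x^-1 = (absp x)^-1.
Proof.
have [->|x0] := eqVneq x 0; first by rewrite invr0 absp0 invr0.
have n0 : absp x != 0 by rewrite (absp_eq0 HK).
by apply: (mulfI n0); rewrite -abspM !mulfV ?absp1.
Qed.

Lemma absp_leD c x y : absp x <= c -> absp y <= c -> absp (x + y) <= c.
Proof. by move=> hx hy; rewrite (le_trans (abspD HK _ _)) // ge_max hx. Qed.

Lemma absp_leB c x y : absp x <= c -> absp y <= c -> absp (x - y) <= c.
Proof. by move=> hx hy; rewrite absp_leD ?abspN. Qed.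

Lemma absp_ltD c x y : absp x < c -> absp y < c -> absp (x + y) < c.
Proof. by move=> hx hy; rewrite (le_lt_trans (abspD HK _ _)) // gt_max hx. Qed.

Lemma absp_ltB c x y : absp x < c -> absp y < c -> absp (x - y) < c.
Proof. by move=> hx hy; rewrite absp_ltD ?abspN. Qed.

Lemma absp_le1M x y : absp x <= 1 -> absp y <= 1 -> absp (x * y) <= 1.
Proof. by move=> hx hy; rewrite abspM mulr_ile1 ?absp_ge0. Qed.

Lemma absp_le1X x n : absp x <= 1 -> absp (x ^+ n) <= 1.
Proof. by move=> hx; rewrite abspX exprn_ile1 ?absp_ge0. Qed.

Lemma absp_lt1M x y : absp x < 1 -> absp y <= 1 -> absp (x * y) < 1.
Proof.
move=> hx hy; rewrite abspM (le_lt_trans _ hx) //.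
by rewrite ler_piMr ?absp_ge0.
Qed.

Lemma absp_lt1Mr x y : absp x <= 1 -> absp y < 1 -> absp (x * y) < 1.
Proof. by move=> hx hy; rewrite mulrC absp_lt1M. Qed.

Lemma absp_nat_le1 n : absp n%:R <= 1.
Proof.
elim: n => [|n IH]; first by rewrite absp0.
by rewrite -natr1 absp_leD ?absp1.
Qed.

Lemma absp_int_le1 z : absp z%:~R <= 1.
Proof. by case: z => n; rewrite ?NegzE ?rmorphN ?abspN absp_nat_le1. Qed.

(** The value group consists of the integral powers of [p], so nothing lies strictly between [1/p]
    and [1]. This gap gives the rate of convergence in Hensel's lemma. *)
Lemma absp_lt1_pV x : absp x < 1 -> absp x <= (p%:R)^-1.
Proof.
have [->|x0] := eqVneq x 0; first by rewrite absp0 invr_ge0 ltW.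
have [z ->] := absp_val HK x0.
by rewrite -(expr0z (p%:R : rat)) ltr_eXz2l // -exprN1 ler_eXz2l //; lia.
Qed.

(** For [z] prime to [p], a Bezout identity [u p + v z = 1] with [|z| < 1] would force [|1| < 1]. *)
Lemma absp_int_lt1 z : (absp z%:~R < 1) = (p %| z)%Z.
Proof.
apply/idP/idP => [|/dvdzP[q ->]]; last first.
  by rewrite rmorphM absp_lt1Mr ?absp_int_le1 //= -pmulrn (absp_p HK).
apply: contraLR => pz; rewrite -leNgt.
have /coprimezP[[u v] /= uv1] : coprimez p z by rewrite coprimezE prime_coprime.
rewrite leNgt; apply/negP => z_lt1.
suff : absp 1 < 1 by rewrite absp1 ltxx.
have -> : 1 = u%:~R * p%:R + v%:~R * z%:~R :> K.
  by rewrite pmulrn -!rmorphM -rmorphD /= uv1.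
by rewrite absp_ltD ?absp_lt1Mr ?absp_int_le1 // (absp_p HK).
Qed.

Lemma absp_nat1 n : (0 < n < p)%N -> absp n%:R = 1.
Proof.
case/andP=> n0 np; apply/eqP; rewrite eq_le absp_nat_le1 leNgt pmulrn.
by rewrite absp_int_lt1 dvdzE !absz_nat gtnNdvd.
Qed.

Lemma absp_eq1_congr x y : absp (x - y) < 1 -> absp x = 1 -> absp y = 1.
Proof.
move=> xy x1; have y_le1 : absp y <= 1.
  by rewrite -[y](subKr x) absp_leB ?x1 // ltW.
apply/eqP; rewrite eq_le y_le1 leNgt; apply/negP => y1.
have : absp x < 1 by rewrite -[x](subrK y) absp_ltD.
by rewrite x1 ltxx.
Qed.

(** * Powers of [p] and Hensel's lemma *)

Lemma p_neq0 : p%:R != 0 :> K.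
Proof. by rewrite -absp_gt0 (absp_p HK) invr_gt0. Qed.

Lemma abspXz z : absp (p%:R ^ z) = p%:R ^ (- z).
Proof.
case: z => n; first by rewrite -exprnP abspX (absp_p HK) exprVn exprnN.
rewrite NegzE opprK -exprnN abspV abspX (absp_p HK) exprVn invrK.
by rewrite -exprnP.
Qed.

Lemma expVn_lt e : 0 < e -> exists n, (p%:R : rat) ^- n < e.
Proof.
move=> e0; exists (Num.bound e^-1); set n := Num.bound _.
rewrite invf_plt ?posrE ?exprn_gt0 //; apply: lt_le_trans (upper_nthrootP (leqnn _)) _.
by apply: lerXn2r; rewrite ?nnegrE ?ler0n // ler_nat prime_gt1.
Qed.

(* Newton's iteration with the derivative frozen at [c] is a contraction. *)
Lemma Hensel_root (f : K -> K) (q : K -> K -> K) (x0 c : K) :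
    (forall x y, f x - f y = (x - y) * q x y) -> absp c = 1 ->
    (forall x y, absp (x - x0) < 1 -> absp (y - x0) < 1 -> absp (q x y - c) < 1) ->
    absp (f x0) < 1 ->
  exists2 x, f x = 0 & absp (x - x0) < 1.
Proof.
move=> fq c1 qc fx0.
have c0 : c != 0 by rewrite -absp_gt0 c1.
have pVge0 n : 0 <= (p%:R : rat) ^- n by rewrite invr_ge0 exprn_ge0 // ltW.
pose s := fix s n := if n is m.+1 then s m - f (s m) / c else x0.
have step_le n : absp (f (s n)) <= p%:R ^- n.+1 /\ absp (s n - x0) < 1.
  elim: n => [|n [fs sx]]; first by rewrite subrr absp0 ltr01 expr1; split=> //; apply: absp_lt1_pV.
  have f_lt1 : absp (f (s n) / c) < 1.
    rewrite abspM abspV c1 invr1 mulr1 (le_lt_trans fs) // -exprVn.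
    by rewrite exprn_ilt1 // invr_ge0 ltW.
  have sx' : absp (s n.+1 - x0) < 1.
    by rewrite /= addrAC absp_ltB.
  split=> //.
  (* The factor [c - q] has absolute value less than [1], hence at most [1/p]: each iteration gains
     one power of [p]. *)
  have -> : f (s n.+1) = f (s n) * (c - q (s n.+1) (s n)) / c.
    rewrite -[LHS](subrK (f (s n))) fq.
    have -> : s n.+1 - s n = - (f (s n) / c) by rewrite /=; ring.
    by field.
  rewrite !abspM abspV c1 invr1 mulr1 exprSr invfM; apply: ler_pM; rewrite ?absp_ge0 //.
  by apply: absp_lt1_pV; rewrite -abspN opprB qc.
have shift_le n k : absp (s (n + k)%N - s n) <= p%:R ^- n.
  elim: k => [|k IH]; first by rewrite addn0 subrr absp0.
  rewrite addnS /= addrAC absp_leB // abspM abspV c1 invr1 mulr1.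
  rewrite (le_trans (step_le _).1) // lef_pV2 ?posrE ?exprn_gt0 //.
  by apply: ler_weXn2l; [apply: ltW | lia].
have [l sl] : exists l, converges absp s l.
  apply: (absp_complete HK) => e /expVn_lt[N Ne]; exists N => m n Nm Nn.
  rewrite (le_lt_trans _ Ne) //.
  have -> : s m - s n = (s m - s N) - (s n - s N) by ring.
  by rewrite -(subnKC Nm) -(subnKC Nn) absp_leB.
have lx0 : absp (l - x0) < 1.
  have [N /(_ N (leqnn _)) sN] := sl 1 ltr01.
  have -> : l - x0 = (s N - x0) - (s N - l) by ring.
  by rewrite absp_ltB // (step_le _).2.
(* If [f l] were nonzero, some [n] would make both [|f (s n)|] and [|s n - l|] smaller than [|f l|],
   and the ultrametric inequality would give [|f l| < |f l|]. *)
exists l => //; apply/eqP; rewrite -[_ == _]negbK -absp_gt0; apply/negP => fl0.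
have [M Mf] := expVn_lt _ fl0; have [N sN] := sl _ fl0.
pose n := maxn M N; have {}sN := sN n (leq_maxr _ _).
suff : absp (f l) < absp (f l) by rewrite ltxx.
rewrite -{1}[f l](subrK (f (s n))) fq absp_ltD //.
  rewrite abspM (le_lt_trans _ sN) // -opprB abspN ler_piMr ?absp_ge0 //.
  rewrite -[q _ _](subrK c) absp_leD ?c1 // ltW // qc //.
  exact: (step_le _).2.
rewrite (le_lt_trans (step_le _).1) // (le_lt_trans _ Mf) //.
rewrite lef_pV2 ?posrE ?exprn_gt0 //; apply: ler_weXn2l; first exact: ltW.
by rewrite leqW // leq_maxl.
Qed.

(** * Square roots in [K] *)

(** A square root reduces modulo [p]; conversely a residue [m] lifts by Hensel, the derivative [2 m]
    of [X^2 - c] being a unit since [p] is odd. *)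
Lemma unit_sqrtP (c : K) (n : int) : absp c = 1 -> absp (c - n%:~R) < 1 ->
  (exists w, w ^+ 2 = c) <-> exists m : nat, (p %| n - m%:Z ^+ 2)%Z.
Proof.
move=> c1 cn; split=> [[w wc]|[m]].
  have w1 : absp w = 1.
    by apply/eqP; rewrite -(@pexpr_eq1 _ _ 2) ?absp_ge0 // -abspX wc c1.
  have [|m _ wm] := @absp_residue _ _ _ HK w; first by rewrite w1.
  exists m; rewrite -absp_int_lt1 rmorphB rmorphXn /= -pmulrn.
  have -> : n%:~R - m%:R ^+ 2 = (w - m%:R) * (w + m%:R) - (c - n%:~R) by rewrite -wc; ring.
  by rewrite absp_ltB // absp_lt1M // absp_leD ?w1 ?absp_nat_le1.
rewrite -absp_int_lt1 rmorphB rmorphXn /= -pmulrn => nm.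
have cm : absp (c - m%:R ^+ 2) < 1.
  have -> : c - m%:R ^+ 2 = (c - n%:~R) + (n%:~R - m%:R ^+ 2) by ring.
  exact: absp_ltD.
have m1 : absp m%:R = 1.
  by apply/eqP; rewrite -(@pexpr_eq1 _ _ 2) ?absp_ge0 // -abspX (absp_eq1_congr _ _ cm).
have [||||w] := Hensel_root (fun x => x ^+ 2 - c) (fun x y => x + y) m%:R (2 * m%:R).
- by move=> x y /=; ring.
- by rewrite abspM m1 absp_nat1 //; lia.
- move=> x y xm ym; have -> : x + y - 2 * m%:R = (x - m%:R) + (y - m%:R) by ring.
  exact: absp_ltD.
- by rewrite -abspN opprB.
by move/eqP; rewrite subr_eq0 => /eqP wc _; exists w.
Qed.

(** Shows that [cstar] multiplies by a power of [p] in [K]. For a negative exponent [-k], numerator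
    times [p^k] equals denominator; by coprimality both cannot vanish in [K], so the quotient
    defining [ratr] is the expected one. *)
Lemma ratr_expz (z : int) : ratr ((p%:R : rat) ^ z) = (p%:R : K) ^ z.
Proof.
case: z => n; first by rewrite -!exprnP -!natrX ratr_nat.
rewrite NegzE -!exprnN; set x : rat := _^-1; set k := n.+1.
have xE : numq x * (p ^ k)%N%:Z = denq x.
  apply: (@intr_inj rat); rewrite rmorphM /= -pmulrn natrX.
  have : x * p%:R ^+ k = 1 by rewrite mulVf // expf_neq0 // gt_eqF.
  rewrite -{1}(divq_num_den x) mulrAC => /(canRL (mulfVK _)) ->; last by rewrite intr_eq0 denq_neq0.
  by rewrite mul1r.
have pk0 : (p%:R : K) ^+ k != 0 by rewrite expf_neq0 // p_neq0.
have xK : (numq x)%:~R * p%:R ^+ k = (denq x)%:~R :> K.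
  by rewrite -xE rmorphM /= -pmulrn natrX.
have n0 : (numq x)%:~R != 0 :> K.
  apply/eqP => n0; have /coprimezP[[u v] /= uv1] : coprimez (numq x) (denq x).
    by rewrite coprimezE coprime_num_den.
  have : (1 : int)%:~R = 0 :> K by rewrite -uv1 rmorphD !rmorphM /= -xK n0; ring.
  by move/eqP; rewrite oner_eq0.
by rewrite /ratr -xK invfM mulrA divff // mul1r.
Qed.

Lemma absp_cstar c : c != 0 -> absp (cstar absp c) = 1.
Proof.
move=> c0; rewrite /cstar abspM; have [z cz] := absp_val HK c0.
by rewrite {2}cz ratr_expz abspXz cz -expfzDr ?gt_eqF // subrr.
Qed.

Lemma digit0P c : c != 0 ->
  (digit0 p absp c < p)%N /\ absp (cstar absp c - (digit0 p absp c)%:R) < 1.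
Proof.
move=> c0; have [|n np cn] := @absp_residue _ _ _ HK (cstar absp c); first by rewrite absp_cstar.
have hs : has (fun n : nat => absp (cstar absp c - n%:R) < 1) (iota 0 p).
  by apply/hasP; exists n; rewrite // mem_iota.
have lt_p : (digit0 p absp c < p)%N by move: hs; rewrite has_find size_iota.
by split=> //; have := nth_find 0%N hs; rewrite nth_iota.
Qed.

Lemma digit0_ndvd c : c != 0 -> ~~ (p %| digit0 p absp c)%N.
Proof.
move=> c0; have [_ cn] := digit0P c c0.
rewrite -[X in ~~ X]/(p %| Posz (digit0 p absp c))%Z -absp_int_lt1 -pmulrn.
by rewrite (absp_eq1_congr _ _ cn) ?ltxx // absp_cstar.
Qed.

(** Squares have even valuation, and an even power of [p] can be moved between [c] and [cstar c]
    without affecting squareness; for the unit [cstar c] the Euler criterion on its first digit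
    decides. *)
Lemma sqrt_existsP c : sqrt_exists p absp c <-> exists w, w ^+ 2 = c.
Proof.
have [->|c0] := eqVneq c 0.
  by split=> _; [exists 0; rewrite expr0n | left].
have [_ cn] := digit0P c c0; rewrite [in X in absp X]pmulrn in cn.
have S := unit_sqrtP _ _ (absp_cstar _ c0) cn.
have E := Euler_criterion_mod p (digit0 p absp c) pp _ (digit0_ndvd _ c0).
have {S E} : (exists w, w ^+ 2 = cstar absp c) <->
    (digit0 p absp c ^ ((p - 1) %/ 2) = 1 %[mod p])%N.
  rewrite S E //; case: (even_prime pp) => // p2; lia.
have pz0 (z : int) : (p%:R : K) ^ z != 0 by rewrite expfz_neq0 // p_neq0.
move=> S; split=> [[/eqP|[[k ck] /S[w wc]]]|[w wc]]; first by rewrite (negPf c0).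
  exists (w / p%:R ^ k); rewrite expr_div_n wc /cstar ck ratr_expz.
  by rewrite exprnP exprz_exp mulfK.
have w0 : w != 0 by apply: contraNneq c0 => w0; rewrite -wc w0 expr0n.
have [z wz] := absp_val HK w0.
have cz : absp c = p%:R ^ (z * 2) by rewrite -wc abspX wz exprnP exprz_exp.
right; split; first by exists z.
apply/S; exists (w * p%:R ^ z).
by rewrite exprMn wc /cstar cz ratr_expz -exprz_exp.
Qed.

(** Once the exponent of [|c|] is known, only its parity and a congruence between naturals remain to
    be tested. *)
Lemma sqrt_exists_dec c : sqrt_exists p absp c \/ ~ sqrt_exists p absp c.
Proof.
have [->|c0] := eqVneq c 0; first by left; left.
have [z cz] := absp_val HK c0.
case: (eqVneq (z %% 2)%Z 0) => [z2|z2]; last first.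
  right=> -[/eqP|[[k]]]; first by rewrite (negPf c0).
  rewrite cz => /ieexprIz zk; move: z2; rewrite zk ?modzMl ?eqxx //.
  by rewrite gt_eqF.
case: (eqVneq (digit0 p absp c ^ ((p - 1) %/ 2) %% p)%N (1 %% p)%N) => d.
  left; right; split=> //; exists (z %/ 2)%Z.
  by rewrite cz {1}(divz_eq z 2) z2 addr0.
by right=> -[/eqP|[_ /eqP]]; rewrite ?(negPf c0) ?(negPf d).
Qed.

(** * Lifting a simple root of the normalized cubic, and the two conditions *)

Ltac integral :=
  repeat first [ done | by apply: ltW
               | match goal with H : absp ?x = 1 |- is_true (absp ?x <= 1) => by rewrite H end
               | exact: absp_nat_le1 | exact: absp_int_le1
               | apply: absp_leD | apply: absp_leB | apply: absp_le1M
               | apply: absp_le1X | rewrite abspN ].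

Lemma disc_congr (A B : K) (m n : int) :
    absp A <= 1 -> absp B <= 1 ->
    absp (A - m%:~R) < 1 -> absp (B - n%:~R) < 1 ->
  absp (- (4%:R * A ^+ 3) - 27%:R * B ^+ 2 - (D0 m n)%:~R) < 1.
Proof.
move=> A1 B1 Am Bn; rewrite /D0 rmorphB rmorphN !rmorphM /=.
have -> : - (4%:R * A ^+ 3) - 27%:R * B ^+ 2 - (- (4%:~R * (m%:~R * (m%:~R * m%:~R)))
    - 27%:~R * (n%:~R * n%:~R)) =
    (A - m%:~R) * (- (4%:R * (A ^+ 2 + A * m%:~R + m%:~R ^+ 2))) +
    (B - n%:~R) * (- (27%:R * (B + n%:~R))) by ring.
by apply: absp_ltD; apply: absp_lt1M => //; integral.
Qed.

(** The derivative at the lifted root is congruent to the one at [x0], hence nonzero; its square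
    later relates [D] to the discriminant of the quadratic cofactor. *)
Lemma cubic_Hensel (A B x0 : K) :
    absp A <= 1 -> absp x0 <= 1 ->
    absp (x0 ^+ 3 + A * x0 - B) < 1 -> absp (3%:R * x0 ^+ 2 + A) = 1 ->
  exists2 y, y ^+ 3 + A * y = B & 3%:R * y ^+ 2 + A != 0.
Proof.
move=> A1 x1 fx dfx.
have [||||y] := Hensel_root (fun x => x ^+ 3 + A * x - B)
    (fun x y => x ^+ 2 + x * y + y ^+ 2 + A) x0 (3%:R * x0 ^+ 2 + A) => //.
- by move=> x y /=; ring.
- move=> x y hx hy /=.
  have x_le1 : absp x <= 1 by rewrite -[x](subrK x0); integral.
  have y_le1 : absp y <= 1 by rewrite -[y](subrK x0); integral.
  have -> : x ^+ 2 + x * y + y ^+ 2 + A - (3%:R * x0 ^+ 2 + A) =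
      (x - x0) * (x + x0 + y) + (y - x0) * (y + x0 + x0) by ring.
  by apply: absp_ltD; apply: absp_lt1M => //; integral.
move/eqP; rewrite subr_eq0 => /eqP fy hy; exists y => //.
have y_le1 : absp y <= 1 by rewrite -[y](subrK x0); integral.
rewrite -absp_gt0 (@absp_eq1_congr (3%:R * x0 ^+ 2 + A)) //.
have -> : 3%:R * x0 ^+ 2 + A - (3%:R * y ^+ 2 + A) = (y - x0) * (- (3%:R * (y + x0))) by ring.
by apply: absp_lt1M => //; integral.
Qed.

Lemma cubic_unit_root (A B : K) (m n : int) (D := - (4%:R * A ^+ 3) - 27%:R * B ^+ 2) :
    absp A = 1 -> absp B = 1 ->
    absp (A - m%:~R) < 1 -> absp (B - n%:~R) < 1 ->
    ~ (D0 m n * useq m n (p - 2) ^+ 2 = 9 * m ^+ 2 %[mod p%:Z])%Z ->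
  exists2 y, y ^+ 3 + A * y = B & 3%:R * y ^+ 2 + A != 0.
Proof.
move=> A1 B1 Am Bn not9.
have A0 : A != 0 by rewrite -absp_gt0 A1.
have D_le1 : absp D <= 1 by rewrite /D; integral.
have n3 : absp 3%:R = 1 by apply: absp_nat1; lia.
have [D_lt1|D1] := ltP (absp D) 1.
(* Modulo [p] the cubic has the double root [3B/2A] and the simple root [-3B/A]. *)
- have AV : absp A^-1 <= 1 by rewrite abspV A1 invr1.
  apply: (@cubic_Hensel A B (- (3%:R * B / A))); try by integral.
    have -> : (- (3%:R * B / A)) ^+ 3 + A * - (3%:R * B / A) - B = D * (B * A^-1 ^+ 3).
      by rewrite /D; field.
    by apply: absp_lt1M => //; integral.
  apply: (@absp_eq1_congr (- (3%:R * A))); last by rewrite abspN abspM n3 A1 mulr1.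
  have -> : - (3%:R * A) - (3%:R * (- (3%:R * B / A)) ^+ 2 + A) = D * A^-1 ^+ 2.
    by rewrite /D; field.
  by apply: absp_lt1M => //; integral.
have DD0 : absp (D - (D0 m n)%:~R) < 1 by apply: disc_congr => //; integral.
have pD0 : ~~ (p %| D0 m n)%Z.
  rewrite -absp_int_lt1 (absp_eq1_congr _ _ DD0) ?ltxx //.
  by apply/eqP; rewrite eq_le D_le1.
have pn : ~~ (p %| n)%Z by rewrite -absp_int_lt1 (absp_eq1_congr _ _ Bn) ?ltxx.
have [[k fk] _] := cubic_residue_mod p m n pp p_gt3 pD0 pn not9.
set x : K := k%:R; have x1 : absp x <= 1 by apply: absp_nat_le1.
have fx : absp (x ^+ 3 + A * x - B) < 1.
  have -> : x ^+ 3 + A * x - B =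
      (k%:Z ^+ 3 + m * k%:Z - n)%:~R + ((A - m%:~R) * x - (B - n%:~R)).
    by rewrite rmorphB rmorphD rmorphXn rmorphM /= -pmulrn -/x; ring.
  apply: absp_ltD; first by rewrite absp_int_lt1.
  by apply: absp_ltB => //; apply: absp_lt1M.
apply: (@cubic_Hensel A B x) => //; first by integral.
apply/eqP; rewrite eq_le; apply/andP; split; first by integral.
rewrite leNgt; apply: contraTN D1 => dfx; rewrite -ltNge.
set f := x ^+ 3 + A * x - B in fx *; set g := 3%:R * x ^+ 2 + A in dfx *.
(* [D] lies in the ideal generated by the value [f] and the derivative [g], so a multiple root
   modulo [p] would force [|D| < 1]. *)
have -> : D = g * (g * (9%:R * x ^+ 2 - 4%:R * g)) +
    f * (54%:R * x * g - 27%:R * f - 108%:R * x ^+ 3) by rewrite /D /f /g; ring.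
by apply: absp_ltD; apply: absp_lt1M => //; integral.
Qed.

(** For [|D| = 1], being a square depends only on the residue [D0] of [D], which [cubic_residue_mod]
    links to [u_(p-2)]. For [|D| < 1] the conditions speak of [sqrt_exists] directly, and [D = 0]
    falls under ( * ). *)
Lemma cond_dichotomy (a b : K) : a != 0 -> b != 0 -> in_Delta2 p absp a b ->
  (cond_star p absp a b /\ exists w, w ^+ 2 = Disc absp a b) \/
  (cond_2star p absp a b /\ ~ exists w, w ^+ 2 = Disc absp a b).
Proof.
move=> an0 bn0 [_ not9]; set D := Disc absp a b.
have [A1 B1] := (absp_cstar _ an0, absp_cstar _ bn0).
have [_ Am] := digit0P _ an0; have [_ Bn] := digit0P _ bn0.
have DD0 : absp (D - (D0 (a0 p absp a) (b0 p absp b))%:~R) < 1.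
  by apply: disc_congr; rewrite ?A1 ?B1 // -pmulrn.
have D_le1 : absp D <= 1 by rewrite /D /Disc; integral.
have [D_lt1|D_ge1] := ltP (absp D) 1.
  have [sD|sD] := sqrt_exists_dec D.
    by left; split; [right | apply/sqrt_existsP].
  right; split; last by move/sqrt_existsP.
  right; split=> //; rewrite D_lt1 absp_gt0 andbT.
  by apply/eqP => D0; apply: sD; left.
have D1 : absp D = 1 by apply/eqP; rewrite eq_le D_le1.
have pD0 : ~~ (p %| D0 (a0 p absp a) (b0 p absp b))%Z.
  by rewrite -absp_int_lt1 (absp_eq1_congr _ _ DD0) ?ltxx.
have [_ sq] := cubic_residue_mod p _ _ pp p_gt3 pD0 (digit0_ndvd _ bn0) not9.
have S := unit_sqrtP D _ D1 DD0.
have [u0|u0] := eqVneq (Dint p absp a b %% p)%Z (0 %% p)%Z.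
  by left; split; [left | apply/S/sq].
right; split; last by move/S/sq/eqP; rewrite (negPf u0).
by left; split=> //; split=> // /eqP; rewrite (negPf u0).
Qed.

(** * Rescaling, and the factorization of the original cubic *)

Lemma cubic_scaling (a b : K) : a != 0 -> b != 0 -> absp a ^+ 3 = absp b ^+ 2 ->
  exists t, [/\ t != 0, cstar absp a = a * t ^+ 2 & cstar absp b = b * t ^+ 3].
Proof.
move=> an0 bn0; have [[i ai] [j bj]] := (absp_val HK an0, absp_val HK bn0).
rewrite ai bj !exprnP !exprz_exp => /ieexprIz ij.
have {}ij : i * 3 = j * 2 by apply: ij; rewrite // gt_eqF.
(* From [3 i = 2 j] follow [i = 2 (j - i)] and [j = 3 (j - i)]. *)
exists (p%:R ^ (j - i)); split; first by rewrite expfz_neq0 // p_neq0.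
  by rewrite /cstar ai ratr_expz exprnP exprz_exp; congr (_ * _ ^ _); lia.
by rewrite /cstar bj ratr_expz exprnP exprz_exp; congr (_ * _ ^ _); lia.
Qed.

(** The rescaled root [y = r t] is a unit: [|y| < 1] would make [cstar b] a nonunit, and for
    [|y| > 1] division by [y^3] would give [|1| < 1]. Since [|b| |t|^3 = 1], scaling back gives the
    claim. *)
Lemma cubic_root_absp (a b r : K) : a != 0 -> b != 0 -> absp a ^+ 3 = absp b ^+ 2 ->
  r ^+ 3 + a * r = b -> absp r ^+ 3 = absp b.
Proof.
move=> an0 bn0 ab rb; have [t [tn0 At Bt]] := cubic_scaling a b an0 bn0 ab.
have [A1 B1] := (absp_cstar _ an0, absp_cstar _ bn0).
pose y := r * t.
have yB : y ^+ 3 + cstar absp a * y = cstar absp b by rewrite At Bt -rb /y; ring.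
have tA : absp t ^+ 3 != 0 by rewrite -abspX (absp_eq0 HK) expf_neq0.
have tB : absp b * absp t ^+ 3 = 1 by rewrite -abspX -abspM -Bt.
apply: (mulIf tA); rewrite tB -exprMn -abspM -/y.
have [y_le1|y_gt1] := leP (absp y) 1.
  have [y_lt1|y_ge1] := ltP (absp y) 1; last first.
    by rewrite (_ : absp y = 1) ?expr1n //; apply/eqP; rewrite eq_le y_le1.
  suff : absp (cstar absp b) < 1 by rewrite B1 ltxx.
  rewrite -yB (_ : _ + _ = y * (y ^+ 2 + cstar absp a)); last by ring.
  by apply: absp_lt1M => //; integral.
have y0 : y != 0 by rewrite -absp_gt0 (lt_trans ltr01).
suff : absp (1 : K) < 1 by rewrite absp1 ltxx.
have -> : 1 = y^-1 * ((cstar absp b * y^-1 - cstar absp a) * y^-1).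
  by rewrite -yB; field.
have yV : absp y^-1 < 1 by rewrite abspV invf_lt1 // (lt_trans ltr01).
by apply: absp_lt1M => //; integral.
Qed.

Lemma cubic_factorization (a b : K) : a != 0 -> b != 0 -> in_Delta2 p absp a b ->
  exists s : seq K,
    [/\ (size s = 3 /\ cond_star p absp a b) \/ (size s = 1 /\ cond_2star p absp a b),
        all (fun r => absp r ^+ 3 == absp b) s &
        exists g, cubic a b = (\prod_(r <- s) ('X - r%:P)) * g /\ forall x, ~~ root g x].
Proof.
move=> an0 bn0 ab2; have [ab not9] := ab2.
have [t [tn0 At Bt]] := cubic_scaling a b an0 bn0 ab.
have [A1 B1] := (absp_cstar _ an0, absp_cstar _ bn0).
have [_ Am] := digit0P _ an0; have [_ Bn] := digit0P _ bn0.
have [|||y yB dy] := cubic_unit_root _ _ (a0 p absp a) (b0 p absp b) A1 B1.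
- by rewrite -pmulrn.
- by rewrite -pmulrn.
- exact: not9.
have n2 : 2%:R != 0 :> K by rewrite -absp_gt0 absp_nat1 //; lia.
pose r := y / t.
have yr : y = r * t by rewrite divfK.
have rb : r ^+ 3 + a * r = b.
  have t3 : t ^+ 3 != 0 by rewrite expf_neq0.
  by apply: (mulIf t3); rewrite -Bt -yB At yr; ring.
pose d := 3%:R * r ^+ 2 + a.
have dn0 : d != 0.
  apply: contraNneq dy => d0; rewrite yr At.
  have -> : 3%:R * (r * t) ^+ 2 + a * t ^+ 2 = d * t ^+ 2 by rewrite /d; ring.
  by rewrite d0 mul0r.
(* The first factor is the discriminant of the cofactor [q], so it is a square exactly when [D]
   is. *)
have DE : Disc absp a b = (- (3%:R * r ^+ 2) - 4%:R * a) * (t ^+ 3 * d) ^+ 2.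
  by rewrite /Disc At Bt -rb /d; ring.
have td0 : t ^+ 3 * d != 0 by rewrite mulf_neq0 ?expf_neq0.
pose q : {poly K} := 'X^2 + r *: 'X + (r ^+ 2 + a)%:P.
have fE : cubic a b = ('X - r%:P) * q.
  rewrite /cubic /q -rb -!mul_polyC !rmorphD !rmorphM /=; ring.
have rootf x : root (cubic a b) x -> absp x ^+ 3 == absp b.
  rewrite /cubic rootE !hornerE subr_eq0 => /eqP xb; apply/eqP.
  exact: (cubic_root_absp a b x).
have [[star [w wD]]|[star2 nsq]] := cond_dichotomy a b an0 bn0 ab2.
  pose v := w / (t ^+ 3 * d).
  have vE : v ^+ 2 = - (3%:R * r ^+ 2) - 4%:R * a.
    by rewrite expr_div_n wD DE mulfK // expf_neq0.
  have fE3 : cubic a b = \prod_(x <- [:: r; (v - r) / 2%:R; (- v - r) / 2%:R]) ('X - x%:P).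
    rewrite !big_cons big_nil mulr1 fE; congr (_ * _).
    rewrite /q; set x1 := (v - r) / 2; set x2 := (- v - r) / 2.
    have -> : r = - (x1 + x2) by rewrite /x1 /x2; field.
    have -> : (- (x1 + x2)) ^+ 2 + a = x1 * x2.
      have n4 : 4%:R != 0 :> K by rewrite (natrM _ 2 2) mulf_neq0.
      have aE : a = (- v ^+ 2 - 3%:R * r ^+ 2) / 4.
        by apply: (mulIf n4); rewrite divfK // vE; ring.
      by rewrite aE /x1 /x2; field; rewrite n2.
    by rewrite -mul_polyC rmorphN rmorphD /= (polyCM x1); ring.
  exists [:: r; (v - r) / 2%:R; (- v - r) / 2%:R]; split; first by left.
    by apply/allP => x xs; apply: rootf; rewrite fE3 root_prod_XsubC.
  by exists 1; rewrite mulr1; split=> // x; rewrite root1.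
exists [:: r]; split; first by right.
  rewrite /= andbT; apply: rootf; rewrite fE rootM root_XsubC eqxx //.
exists q; rewrite big_cons big_nil mulr1; split=> // x; apply/negP.
rewrite rootE /q !hornerE => /eqP qx; apply: nsq.
(* A root [x] of [q] makes [2 x + r] a square root of its discriminant. *)
exists ((2%:R * x + r) * (t ^+ 3 * d)); rewrite exprMn DE; congr (_ * _).
apply/eqP; rewrite -subr_eq0; apply/eqP.
transitivity (4%:R * (x ^+ 2 + r * x + r ^+ 2 + a)); first by ring.
by rewrite [X in _ * X]qx mulr0.
Qed.

End Padic.

(** * Uniqueness of the list of roots, and the six equivalences *)

(** This makes the root count in [solvable_in] well defined. The head of [s] is not a root of [h],
    so it occurs in [t]; cancel its linear factor and induct. *)
Lemma rootless_cofactor_perm (F : fieldType) (s t : seq F) (g h : {poly F}) :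
    (forall x, ~~ root g x) -> (forall x, ~~ root h x) ->
    (\prod_(r <- s) ('X - r%:P)) * g = (\prod_(r <- t) ('X - r%:P)) * h ->
  perm_eq s t.
Proof.
move=> gr hr; elim: s t => [|x s IH] t.
  case: t => [//|y t]; rewrite big_nil mul1r big_cons => E.
  by move: (gr y); rewrite E !rootM root_XsubC eqxx.
move=> E; have xt : x \in t.
  have : root ((\prod_(r <- x :: s) ('X - r%:P)) * g) x.
    by rewrite big_cons !rootM root_XsubC eqxx.
  by rewrite E rootM (negPf (hr x)) orbF root_prod_XsubC.
rewrite perm_sym (permPl (perm_to_rem xt)) perm_sym perm_cons; apply: IH.
have X0 : 'X - x%:P != 0 by rewrite polyXsubC_eq0.
move: E; rewrite (perm_big _ (perm_to_rem xt)) !big_cons -!mulrA.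
exact: mulfI.
Qed.

Lemma cond_star_2star (p : nat) (K : fieldType) (absp : K -> rat) (a b : K) :
  cond_star p absp a b -> cond_2star p absp a b -> False.
Proof.
rewrite /cond_star /cond_2star => -[[D1 u0]|[Dlt sD]] [[D1' [nu0 _]]|[/andP[_ Dlt'] nsD]] //.
  by move: Dlt'; rewrite D1 ltxx.
by move: Dlt; rewrite D1' ltxx.
Qed.

Theorem mainTheorem2 (p : nat) (K : fieldType) (absp : K -> rat)
  (HK : is_Qp p K absp) (pp : prime p) (p_gt3 : (3 < p)%N)
  (a b : K) (hab : a * b != 0) (hD : in_Delta2 p absp a b) :
  (solvable_in (Zp_unit absp) 3 (cubic a b) <->
     absp b = 1 /\ cond_star p absp a b) /\
  (solvable_in (Zp_nonunit absp) 3 (cubic a b) <->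
     absp b < 1 /\ cond_star p absp a b) /\
  (solvable_in (Qp_nonint absp) 3 (cubic a b) <->
     1 < absp b /\ cond_star p absp a b) /\
  (solvable_in (Zp_unit absp) 1 (cubic a b) <->
     absp b = 1 /\ cond_2star p absp a b) /\
  (solvable_in (Zp_nonunit absp) 1 (cubic a b) <->
     absp b < 1 /\ cond_2star p absp a b) /\
  (solvable_in (Qp_nonint absp) 1 (cubic a b) <->
     1 < absp b /\ cond_2star p absp a b).
Proof.
move: (hab); rewrite mulf_eq0 negb_or => /andP[an0 bn0].
have [s [scond sb [g [fE gr]]]] := cubic_factorization _ _ _ HK pp p_gt3 a b an0 bn0 hD.
have s_gt0 : (0 < size s)%N by case: scond => -[->].
(* All roots have the same absolute value, so they lie in [A] together or not at all; as there is at
   least one root, membership in [A] is equivalent to the condition [P] on [|b|]. *)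
have locate (A : pred K) (P : Prop) n : (forall r, absp r ^+ 3 = absp b -> A r <-> P) ->
    solvable_in A n (cubic a b) <-> P /\ size s = n.
  move=> AP; split=> [[s' [sz' As' [g' [fE' gr']]]]|[hP sn]].
    have ss' : perm_eq s s' by apply: (rootless_cofactor_perm _ _ _ g g'); rewrite -?fE.
    split; last by rewrite (perm_size ss').
    case: s s_gt0 sb ss' {scond fE} => // r s _ /andP[/eqP rb _] ss'.
    by apply/(AP r rb); apply: (allP As'); rewrite -(perm_mem ss') mem_head.
  exists s; split=> //; last by exists g.
  by apply/allP => r rs; apply/(AP r) => //; apply/eqP/(allP sb).
have size3 : size s = 3 <-> cond_star p absp a b.
  by case: scond => -[-> c]; split=> // c'; case: (cond_star_2star p K absp a b).
have size1 : size s = 1 <-> cond_2star p absp a b.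
  by case: scond => -[-> c]; split=> // c'; case: (cond_star_2star p K absp a b).
have ge0 r : 0 <= absp r by apply: absp_ge0 HK pp r.
have unitE r : absp r ^+ 3 = absp b -> Zp_unit absp r <-> absp b = 1.
  by move=> <-; rewrite /Zp_unit -(@pexpr_eq1 _ _ 3) //; split=> /eqP.
have nonunitE r : absp r ^+ 3 = absp b -> Zp_nonunit absp r <-> absp b < 1.
  by move=> <-; rewrite /Zp_nonunit expr_lt1.
have nonintE r : absp r ^+ 3 = absp b -> Qp_nonint absp r <-> 1 < absp b.
  by move=> <-; rewrite /Qp_nonint expr_gt1.
by rewrite -size3 -size1 !(locate _ _ _ unitE) !(locate _ _ _ nonunitE) !(locate _ _ _ nonintE).
Qed.
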